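(* Let $N\in\mathbb{N}$, let $m\geq 0$ be an integer, let $\mathcal{E}$ be a Hilbert space, and let $$K(z,z')=\sum_{w,w'\in\mathcal{F}_N:\,|w|\leq m,\,|w'|\leq m}K_{w,w'}z^w z'^{\,w'^{\top}}\in\mathcal{L}(\mathcal{E})\langle z,z'\rangle$$ be a hereditary polynomial in $2N$ non-commuting indeterminates $z=(z_1,\ldots,z_N)$, $z'=(z'_1,\ldots,z'_N)$. Then $K(Z,Z)\geq 0$ (positive semidefinite) for all $Z\in\mathrm{Nilp}_N(n)$, $n=1,2,\ldots$, if and only if there exist an auxiliary Hilbert space $\mathcal{H}$, of dimension at most $\dim(\mathcal{E})\sum_{j=0}^m N^j$, and a polynomial $$H(z)=\sum_{w\in\mathcal{F}_N:\,|w|\leq m}H_w z^w\in\mathcal{L}(\mathcal{H},\mathcal{E})\langle z\rangle$$ such that $$K(z,z')=H(z)H(z')^*.$$ Furthermore, for this factorization to hold it is enough to assume that $K(Z,Z)\geq 0$ holds for all $Z\in\mathrm{Nilp}_N\left(\sum_{j=0}^m N^j,\,m+1\right)$.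
   Context: Hilbert spaces are complex; $\mathcal{L}(\mathcal{H},\mathcal{E})$ is the space of bounded linear operators from $\mathcal{H}$ to $\mathcal{E}$, and $\mathcal{L}(\mathcal{E})=\mathcal{L}(\mathcal{E},\mathcal{E})$. $\mathcal{F}_N$ is the free semigroup with unit $\emptyset$ (the empty word) on generators $g_1,\ldots,g_N$, with concatenation as multiplication. For $w=g_{j_1}\cdots g_{j_k}\in\mathcal{F}_N$, the transpose is $w^{\top}=g_{j_k}\cdots g_{j_1}$ and the length is $|w|=k$; $\emptyset^{\top}=\emptyset$, $|\emptyset|=0$. Put $z^w=z_{j_1}\cdots z_{j_k}$, $z^{\emptyset}=1$. $\mathcal{L}\langle z_1,\ldots,z_d\rangle$ is the space of all polynomials in non-commuting indeterminates with coefficients in the vector space $\mathcal{L}$. A polynomial in $z,z'$ is called hereditary if it is of the displayed form, i.e., every $z'_j$ appears to the right of every $z_i$ in every monomial. In the factorization $K(z,z')=H(z)H(z')^*$ one uses the convention $(z'^{\,w})^*=z'^{\,w^{\top}}$, so that $H(z')^*=\sum_w H_w^* z'^{\,w^{\top}}$ and the factorization means $K_{w,w'}=H_wH_{w'}^*$ for all $w,w'$ with $|w|,|w'|\leq m$. For $Z=(Z_1,\ldots,Z_N)\in(\mathbb{C}^{n\times n})^N$ and $w=g_{j_1}\cdots g_{j_k}$ put $Z^w=Z_{j_1}\cdots Z_{j_k}$, $Z^{\emptyset}=I_n$, $Z^*=(Z_1^*,\ldots,Z_N^* )$, and $$K(Z,Z)=\sum_{|w|,|w'|\leq m}K_{w,w'}\otimes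 Z^w(Z^* )^{w'^{\top}}\in\mathcal{L}(\mathcal{E}\otimes\mathbb{C}^n).$$ $\mathrm{Nilp}_N(n,r)$ is the set of $N$-tuples $Z\in(\mathbb{C}^{n\times n})^N$ such that $Z^w=0$ for all $w\in\mathcal{F}_N$ with $|w|\geq r$ (jointly nilpotent of rank at most $r$), and $\mathrm{Nilp}_N(n)=\bigcup_{r=1}^\infty\mathrm{Nilp}_N(n,r)$. *)

(* Defs.v *)
From HB Require Import structures.
From mathcomp Require Import all_boot all_order all_algebra.
From mathcomp Require Import sesquilinear spectral complex.
From mathcomp Require Import boolp classical_sets functions cardinality reals.
From mathcomp Require Import topology normedtype.

Set Implicit Arguments.
Unset Strict Implicit.
Unset Printing Implicit Defensive.

Import Order.TTheory GRing.Theory Num.Theory Num.Def.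
Import numFieldNormedType.Exports.

Local Open Scope classical_set_scope.
Local Open Scope ring_scope.
Local Open Scope sesquilinear_scope.
Local Open Scope card_scope.

(* [dot] is linear in its first argument and conjugate-linear in the second. *)
HB.mixin Record isHilbert (R : realType) E & CompleteNormedModule R[i] E := {
  dot : {dot E for conjC};
  dotE : forall x : E, `|x| ^+ 2 = dot x x
}.

#[short(type="hilbertType")]
HB.structure Definition Hilbert (R : realType) :=
  {E of isHilbert R E & CompleteNormedModule R[i] E}.

Section BoundedOperators.
Variables (R : realType) (E F : hilbertType R).

Definition bounded_linear : {pred E -> F} := [pred f |
  `[< linear f /\ exists M : R[i], forall x, `|f x| <= M * `|x| >]].

Lemma bounded_linearP (f : E -> F) :
  reflect (linear f /\ exists2 M : R[i], 0 <= M & forall x, `|f x| <= M * `|x|)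
          (f \in bounded_linear).
Proof.
apply: (iffP (asboolP _)) => -[lf [M]]; last by move=> _ fM; split=> //; exists M.
move=> fM; split=> //; exists `|M| => // x; apply: (le_trans (fM x)).
have : 0 <= M * `|x| by apply: le_trans (fM x).
by move/ger0_norm <-; rewrite normrM normr_id.
Qed.

Lemma bounded_linear_submod : submod_closed bounded_linear.
Proof.
split=> [|a f g /bounded_linearP[lf [M M0 fM]] /bounded_linearP[lg [M' M'0 gM]]].
  apply/bounded_linearP; split=> [a x y|]; first by rewrite scaler0 addr0.
  by exists 0 => // x; rewrite normr0 mul0r.
apply/bounded_linearP; split=> [b x y|].
  rewrite !fctE /= lf lg !scalerDr !scalerA mulrC -!addrA; congr (_ + _).
  by rewrite addrCA.
exists (`|a| * M + M') => [|x]; first by rewrite addr_ge0 ?mulr_ge0.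
rewrite !fctE (le_trans (ler_normD _ _))// mulrDl lerD//.
by rewrite normrZ -mulrA ler_wpM2l.
Qed.

HB.instance Definition _ :=
  GRing.isSubmodClosed.Build R[i] (E -> F) bounded_linear bounded_linear_submod.

Record BL := MkBL { BLfun :> E -> F ; _ : BLfun \in bounded_linear }.

HB.instance Definition _ := [isSub for BLfun].
HB.instance Definition _ := [Choice of BL by <:].
HB.instance Definition _ := [SubChoice_isSubLmodule of BL by <:].

Lemma BL_linear (T : BL) : linear T.
Proof. by case: T => f /= /bounded_linearP[]. Qed.

HB.instance Definition _ (T : BL) :=
  GRing.isLinear.Build R[i] E F *:%R T (BL_linear T).

Lemma BL_bounded (T : BL) :
  exists2 M : R[i], 0 <= M & forall x, `|T x| <= M * `|x|.
Proof. by case: T => f /= /bounded_linearP[]. Qed.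

End BoundedOperators.

Lemma BLcomp_subproof (R : realType) (E F G : hilbertType R)
  (S : BL F G) (T : BL E F) : S \o T \in @bounded_linear R E G.
Proof.
apply/bounded_linearP; split=> [a x y|]; first by rewrite /= !linearP.
have [M M0 SM] := BL_bounded S; have [M' M'0 TM] := BL_bounded T.
exists (M * M') => [|x]; first exact: mulr_ge0.
by rewrite (le_trans (SM _))// -mulrA ler_wpM2l.
Qed.

Definition BLcomp (R : realType) (E F G : hilbertType R)
  (S : BL F G) (T : BL E F) : BL E G := MkBL (BLcomp_subproof S T).

(* By the Riesz representation theorem the set below is a singleton, so the
   default value 0 is never used. *)
Definition adjoint (R : realType) (E F : hilbertType R) (T : BL E F) : BL F E :=
  xget 0 [set S : BL F E | forall x y, dot (T x) y = dot x (S y)].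

Definition psd (R : realType) (E : hilbertType R) (T : BL E E) : Prop :=
  forall x, 0 <= dot (T x) x.

Section HilbertDimension.
Variable R : realType.

Definition orthonormal_set (E : hilbertType R) (B : set E) : Prop :=
  forall x y, B x -> B y -> dot x y = (x == y)%:R.

Definition hilbert_basis (E : hilbertType R) (B : set E) : Prop :=
  orthonormal_set B /\
  forall B' : set E, orthonormal_set B' -> B `<=` B' -> B' = B.

(* dim H <= dim E * k, where dim is the cardinality of an orthonormal basis
   (all orthonormal bases of a Hilbert space are equipotent). *)
Definition hilbert_dim_le_mul (H E : hilbertType R) (k : nat) : Prop :=
  exists (BH : set H) (BE : set E),
    [/\ hilbert_basis BH, hilbert_basis BE & BH #<= BE `*` `I_k].

End HilbertDimension.

(* E (x) C^n, realized as the Hilbert direct sum E^n; see [tensor_pure]. *)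
Definition tensor (R : realType) (E : hilbertType R) (n : nat) : Type :=
  {ffun 'I_n -> E}.

Lemma dot_cauchy_schwarz (C : numClosedFieldType) (U : lmodType C)
  (f : {dot U for conjC}) (u v : U) : `|f u v| ^+ 2 <= f u u * f v v.
Proof.
have [->|v0] := eqVneq v 0; first by rewrite !linear0r normr0 expr0n mulr0.
have fv : 0 < f v v by exact: neq0_dnorm_gt0.
set a := f u v / f v v.
have := dnorm_ge0 f (u - a *: v).
rewrite linearBl !linearBr !linearZl_LR !linearZr_LR /= [f v u]hermC expr0 mul1r.
have -> : a * (a^* * f v v) = a * (f u v)^*.
  rewrite /a rmorphM fmorphV /= (geC0_conj (ltW fv)) -[in RHS](divfK (lt0r_neq0 fv) (f u v)^*).
  by [].
rewrite subrr subr0 subr_ge0 /a rmorphM fmorphV /= (geC0_conj (ltW fv)).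
rewrite -(ler_pM2r fv) mulrAC divfK ?lt0r_neq0// => h.
by rewrite normCK mulrC.
Qed.

Section TensorHilbert.
Variables (R : realType) (E : hilbertType R) (n : nat).
Local Notation T := (tensor E n).

HB.instance Definition _ := GRing.Lmodule.copy T {ffun 'I_n -> E}.

Definition tensor_dot (x y : T) : R[i] := \sum_i dot (x i) (y i).

Lemma tensor_dot_bilinear :
  bilinear_for *%R (conjC \; *%R) tensor_dot.
Proof.
split=> [y a x x'|x a y y'] /=; rewrite mulr_sumr -big_split /=.
  by apply: eq_bigr => i _; rewrite !ffunE linearDl linearZl_LR.
by apply: eq_bigr => i _; rewrite !ffunE linearDr linearZr_LR.
Qed.

HB.instance Definition _ := bilinear_isBilinear.Build R[i] T T R[i]
  *%R (conjC \; *%R) tensor_dot tensor_dot_bilinear.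

Lemma tensor_dot_herm (x y : T) :
  tensor_dot x y = (-1) ^+ false * (tensor_dot y x)^*.
Proof.
rewrite expr0 mul1r rmorph_sum; apply: eq_bigr => i _.
by rewrite hermC expr0 mul1r.
Qed.

HB.instance Definition _ :=
  isHermitianSesquilinear.Build R[i] T false conjC tensor_dot tensor_dot_herm.

Lemma tensor_dot_pos (x : T) : x != 0 -> 0 < tensor_dot x x.
Proof.
move=> x0; rewrite lt0r; apply/andP; split; last first.
  by apply: sumr_ge0 => i _; rewrite -dotE exprn_ge0.
apply: contra_neq x0 => /psumr_eq0P x0; apply/ffunP => i; rewrite ffunE.
apply/eqP; rewrite -normr_eq0 -sqrf_eq0 dotE; apply/eqP/x0 => // j _.

Qed.

HB.instance Definition _ := isDotProduct.Build R[i] T tensor_dot tensor_dot_pos.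

Definition tensor_norm (x : T) : R[i] := sqrtC (tensor_dot x x).

Lemma tensor_norm_triangle (x y : T) :
  tensor_norm (x + y) <= tensor_norm x + tensor_norm y.
Proof.
have dge0 (z : T) : 0 <= tensor_dot z z by exact: (dnorm_ge0 tensor_dot).
rewrite -(@ler_pXn2r _ 2) ?nnegrE ?addr_ge0 ?sqrtC_ge0// sqrrD !sqrtCK.
have cs : `|tensor_dot x y| <= tensor_norm x * tensor_norm y.
  rewrite -(@ler_pXn2r _ 2) ?nnegrE ?mulr_ge0 ?sqrtC_ge0//.
  rewrite exprMn !sqrtCK; exact: (dot_cauchy_schwarz tensor_dot).
rewrite linearDl !linearDr /= [tensor_dot y x]tensor_dot_herm expr0 mul1r.
rewrite addrA lerD2r -addrA lerD2l.
have -> : tensor_dot x y + (tensor_dot x y)^* = 'Re (tensor_dot x y) *+ 2.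
  by rewrite ReE -mulr_natr divfK ?pnatr_eq0.
by rewrite ler_pMn2r// (le_trans _ cs)// leif_Re_Creal.
Qed.

Lemma tensor_normZ (a : R[i]) (x : T) :
  tensor_norm (a *: x) = `|a| * tensor_norm x.
Proof.
rewrite /tensor_norm linearZl_LR linearZr_LR /= mulrA -normCK sqrtCM ?nnegrE//.
  by rewrite sqrCK.
  by rewrite exprn_ge0.
exact: (dnorm_ge0 tensor_dot).
Qed.

Lemma tensor_norm_eq0 (x : T) : tensor_norm x = 0 -> x = 0.
Proof.
by move/eqP; rewrite sqrtC_eq0 => x0; apply/eqP; rewrite -(dnorm_eq0 tensor_dot).
Qed.

HB.instance Definition _ := Lmodule_isNormed.Build R[i] T
  tensor_norm_triangle tensor_normZ tensor_norm_eq0.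

Lemma tensor_le_norm (x : T) i : `|x i| <= `|x|.
Proof.
rewrite -(@ler_pXn2r _ 2) ?nnegrE// [leRHS]sqrtCK dotE.
rewrite [leRHS](bigD1 i)//= lerDl sumr_ge0// => j _.
Qed.

Lemma tensor_norm_le (x : T) : `|x| <= \sum_i `|x i|.
Proof.
rewrite -(@ler_pXn2r _ 2) ?nnegrE ?sumr_ge0// [leLHS]sqrtCK /tensor_dot.
rewrite expr2 mulr_suml ler_sum // => i _; rewrite -dotE expr2 ler_wpM2l//.
by rewrite (bigD1 i)//= lerDl sumr_ge0.
Qed.

Lemma tensor_complete (F : set_system T) : ProperFilter F -> cauchy F -> cvg F.
Proof.
move=> FF /cauchy_ballP Fc.
have cvF i : cvg ((fun x : T => x i) @ F).
  apply: cauchy_cvg; apply/cauchy_ballP => e e0.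
  rewrite near_map2; apply: filterS (Fc _ e0) => -[x y] /=.
  rewrite -!ball_normE /=; apply: le_lt_trans.
  by have := tensor_le_norm (x - y) i; rewrite !ffunE.
apply/cvg_ex; exists [ffun i => lim ((fun x : T => x i) @ F)].
apply/cvgrPdist_lt => e e0; near=> x.
apply: (le_lt_trans (tensor_norm_le _)).
apply: (@le_lt_trans _ _ (\sum_(i < n) e / n.+1%:R)).
  apply: ler_sum => i _; rewrite !ffunE; apply: ltW; move: i.
  near: x; apply: filter_forall => i.
  have /cvgrPdist_lt := cvF i; apply; exact: divr_gt0.
rewrite sumr_const card_ord -[ltLHS]mulr_natr mulrAC ltr_pdivrMr// ltr_pM2l// ltr_nat.
by [].
Unshelve. all: by end_near. Qed.

HB.instance Definition _ := Uniform_isComplete.Build T tensor_complete.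

Lemma tensor_dotE (x : T) : `|x| ^+ 2 = tensor_dot x x.
Proof. exact: sqrtCK. Qed.

HB.instance Definition _ := isHilbert.Build R T tensor_dotE.

End TensorHilbert.

Section TensorOperators.
Variables (R : realType) (E : hilbertType R) (n : nat).

Definition tensor_op_fun (T : BL E E) (A : 'M[R[i]]_n) (x : tensor E n) :
  tensor E n := [ffun i => \sum_j A i j *: T (x j)].

Lemma tensor_op_subproof (T : BL E E) (A : 'M[R[i]]_n) :
  tensor_op_fun T A \in @bounded_linear R (tensor E n) (tensor E n).
Proof.
apply/bounded_linearP; split=> [a x y|].
  apply/ffunP => i; rewrite !ffunE scaler_sumr -big_split; apply: eq_bigr => j _.
  by rewrite !ffunE linearP scalerDr !scalerA mulrC.
have [M M0 TM] := BL_bounded T.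
exists (\sum_i \sum_j `|A i j| * M) => [|x].
  by do 2!apply: sumr_ge0 => ? _; rewrite mulr_ge0.
rewrite (le_trans (tensor_norm_le _))// mulr_suml ler_sum // => i _.
rewrite ffunE (le_trans (ler_norm_sum _ _ _))// mulr_suml ler_sum // => j _.
rewrite normrZ -mulrA ler_wpM2l// (le_trans (TM _))// ler_wpM2l//.
exact: tensor_le_norm.
Qed.

Definition tensor_op (T : BL E E) (A : 'M[R[i]]_n) :
  BL (tensor E n) (tensor E n) := MkBL (tensor_op_subproof T A).

Definition pure_tensor (x : E) (v : 'cV[R[i]]_n) : tensor E n :=
  [ffun i => v i 0 *: x].

Lemma tensor_pure (T : BL E E) (A : 'M[R[i]]_n) x v :
  tensor_op T A (pure_tensor x v) = pure_tensor (T x) (A *m v).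
Proof.
apply/ffunP => i; rewrite !ffunE mxE scaler_suml; apply: eq_bigr => j _.
by rewrite ffunE linearZ scalerA.
Qed.

Lemma dot_pure_tensor x y (v w : 'cV[R[i]]_n) :
  dot (pure_tensor x v) (pure_tensor y w) = dot x y * (w^t* *m v) 0 0.
Proof.
rewrite mxE mulr_sumr.
change (\sum_i dot (pure_tensor x v i) (pure_tensor y w i) = \sum_i dot x y *
  (w^t* 0 i * v i 0)); apply: eq_bigr => i _.
rewrite !ffunE !mxE linearZl_LR linearZr_LR /= mulrA [RHS]mulrC.
by congr (_ * _); exact: mulrC.
Qed.

End TensorOperators.

Section Nilpotent.
Variables (R : realType) (N n : nat).
Implicit Type Z : 'I_N -> 'M[R[i]]_n.

(* A word g_{j_1} ... g_{j_k} is the sequence [:: j_1; ...; j_k]; its transpose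
   is [rev w]. *)
Definition word_pow Z (w : seq 'I_N) : 'M[R[i]]_n := \prod_(j <- w) Z j.

Definition Nilp_rank (r : nat) : set ('I_N -> 'M[R[i]]_n) :=
  [set Z | forall w : seq 'I_N, (r <= size w)%N -> word_pow Z w = 0].

Definition Nilp : set ('I_N -> 'M[R[i]]_n) :=
  \bigcup_(r in [set r | (0 < r)%N]) Nilp_rank r.

End Nilpotent.

(* A polynomial of degree at most m is given by its coefficients, indexed by
   the words of length at most m. *)
Definition ncpoly (N m : nat) (V : Type) := m.-bseq 'I_N -> V.

(* [K w w'] is the coefficient of z^w z'^(w'^T). *)
Definition hereditary (N m : nat) (V : Type) :=
  m.-bseq 'I_N -> m.-bseq 'I_N -> V.

Section HereditaryPolynomials.
Variables (R : realType) (N m : nat) (E : hilbertType R).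

(* The value K(Z, Z), in which Z^* is substituted for z'. *)
Definition heval (K : hereditary N m (BL E E)) (n : nat)
    (Z : 'I_N -> 'M[R[i]]_n) : BL (tensor E n) (tensor E n) :=
  \sum_(w : m.-bseq 'I_N) \sum_(w' : m.-bseq 'I_N)
    tensor_op (K w w')
      (word_pow Z w *m word_pow (fun j => (Z j)^t*) (rev w')).

(* H(z)H(z')^*, where H(z')^* = \sum_w (H w)^* z'^(w^T). *)
Definition herm_square (H : hilbertType R) (P : ncpoly N m (BL H E)) :
    hereditary N m (BL E E) :=
  fun w w' => BLcomp (P w) (adjoint (P w')).

End HereditaryPolynomials.

(* Main.v *)
Require Import Defs.
From mathcomp Require Import all_boot all_order all_algebra complex.
From mathcomp Require Import boolp classical_sets reals topology normedtype.
From mathcomp Require Import sesquilinear cardinality ring lra.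

(** The point is that positivity of K on jointly nilpotent tuples is the same
    as positivity of the block operator [K_{w,w'}], indexed by the words of
    length at most m, on the space E^d, d being the number of these words.

    If K = H(z)H(z')^*, then K(Z, Z) = H(Z)H(Z)^*, so its quadratic form is a
    sum of squared norms ([psd_herm_square]).  That the adjoints H_w^* have
    their defining property rests on the Riesz representation theorem
    ([riesz], [dot_adjoint]).

    Conversely, let Z_j be the truncated creation operators e_v -> e_{jv} on
    the space with basis e_v, |v| <= m; they are nilpotent of rank m+1.  Then
    Z^w (Z^{w'})^* is the sum over v of the matrix units at (wv, w'v), and the
    term of the empty v yields exactly the block operator.  The other terms
    are damped by conjugating Z with a diagonal matrix that is 1 at the empty
    word and s elsewhere: after rescaling the test vector, the quadratic form
    of K(Z, Z) is that of the block operator plus s^2 times a quantity that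
    does not depend on s.  Letting s tend to 0, the block operator is
    positive ([psd_shift_block]).

    A positive block operator T has a self-adjoint square root S ([psd_sqrt]),
    and S = S^* reads K_{w,w'} = H_w H_{w'}^* with H_w the row w of S
    ([psd_block_factor]).  The auxiliary space is E^d itself; its canonical
    basis, made of d copies of an orthonormal basis of E, gives the bound on
    the dimension ([hilbert_dim_tensor]). *)

Set Implicit Arguments.
Unset Strict Implicit.
Unset Printing Implicit Defensive.
Import Order.TTheory GRing.Theory Num.Theory numFieldNormedType.Exports.

Local Open Scope complex_scope.
Local Open Scope ring_scope.
Local Notation Re := complex.Re.
Local Notation Im := complex.Im.

(** * Real-valued norms and inner products *)

Section RealNorm.
Variables (R : realType) (V : normedZmodType R[i]).
Implicit Types x y : V.

(** Norms take values in R[i], whose order is partial; the real part of a norm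
    carries the same information and is accessible to real arithmetic. *)
Definition rnorm x : R := Re `|x|.

Lemma normE x : `|x| = (rnorm x)%:C.
Proof.
rewrite /rnorm; have := normr_ge0 x.
by case: `|x| => a b; rewrite lecE /= => /andP[/eqP-> _].
Qed.

Lemma rnorm_ge0 x : 0 <= rnorm x.
Proof. by rewrite -ler0c -normE. Qed.

Lemma rnormD x y : rnorm (x + y) <= rnorm x + rnorm y.
Proof. by rewrite -lecR rmorphD /= -!normE ler_normD. Qed.

Lemma rnormN x : rnorm (- x) = rnorm x.
Proof. by rewrite /rnorm normrN. Qed.

Lemma rnormC x y : rnorm (x - y) = rnorm (y - x).
Proof. by rewrite -rnormN opprB. Qed.

Lemma rnormB x y : rnorm (x - y) <= rnorm x + rnorm y.
Proof. by rewrite -(rnormN y) rnormD. Qed.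

Lemma rnorm0 : rnorm (0 : V) = 0.
Proof. by rewrite /rnorm normr0. Qed.

Lemma rnorm0_eq0 x : rnorm x = 0 -> x = 0.
Proof. by move=> x0; apply: normr0_eq0; rewrite normE x0. Qed.

Lemma rnorm_sub_trans z x y : rnorm (x - y) <= rnorm (x - z) + rnorm (z - y).
Proof. by rewrite -[x - y](subrKA z) rnormD. Qed.

End RealNorm.

Lemma rnormZ (R : realType) (V : normedModType R[i]) (a : R[i]) (x : V) :
  rnorm (a *: x) = rnorm a * rnorm x.
Proof. by apply: complexI; rewrite rmorphM /= -!normE normrZ. Qed.

Lemma rnorm_real (R : realType) (a : R) : rnorm (a%:C : R[i]) = `|a|.
Proof. by rewrite /rnorm normc_def /= expr0n addr0 sqrtr_sqr. Qed.

Lemma Re_le_rnorm (R : realType) (z : R[i]) : `|Re z| <= rnorm z.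
Proof. by rewrite -lecR -normE normc_ge_Re. Qed.

Section Dot.
Variables (R : realType) (E : hilbertType R).
Implicit Types x y z : E.

Lemma dotDl x y z : dot (x + y) z = dot x z + dot y z.
Proof. by rewrite linearDl. Qed.

Lemma dotDr x y z : dot z (x + y) = dot z x + dot z y.
Proof. by rewrite linearDr. Qed.

Lemma dotBl x y z : dot (x - y) z = dot x z - dot y z.
Proof. by rewrite linearBl. Qed.

Lemma dotBr x y z : dot z (x - y) = dot z x - dot z y.
Proof. by rewrite linearBr. Qed.

Lemma dotZl a x y : dot (a *: x) y = a * dot x y.
Proof. by rewrite linearZl_LR. Qed.

Lemma dotZr a x y : dot x (a *: y) = a^* * dot x y.
Proof. by rewrite linearZr_LR. Qed.

Lemma dotC x y : dot x y = (dot y x)^*.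
Proof. by rewrite hermC expr0 mul1r. Qed.

Lemma dot0l x : dot 0 x = 0.
Proof. by rewrite linear0l. Qed.

Lemma dot0r x : dot x 0 = 0.
Proof. by rewrite linear0r. Qed.

Lemma dot_suml I (r : seq I) (P : pred I) (F : I -> E) y :
  dot (\sum_(i <- r | P i) F i) y = \sum_(i <- r | P i) dot (F i) y.
Proof. by rewrite linear_sumlz. Qed.

Lemma dot_sumr I (r : seq I) (P : pred I) (F : I -> E) y :
  dot y (\sum_(i <- r | P i) F i) = \sum_(i <- r | P i) dot y (F i).
Proof. by rewrite linear_sumr. Qed.

Lemma dot_ge0 x : 0 <= dot x x.
Proof. by rewrite -dotE exprn_ge0. Qed.

Lemma dot_eq0 x : dot x x = 0 -> x = 0.
Proof. by rewrite -dotE => /eqP; rewrite sqrf_eq0 normr_eq0 => /eqP. Qed.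

Lemma dot_inj x y : (forall z, dot z x = dot z y) -> x = y.
Proof.
move=> xy; apply/eqP; rewrite -subr_eq0; apply/eqP/dot_eq0.
by rewrite dotBr xy subrr.
Qed.

Lemma Re_dotxx x : Re (dot x x) = rnorm x ^+ 2.
Proof. by rewrite -dotE normE -rmorphXn. Qed.

Lemma dotxxE x : dot x x = (rnorm x ^+ 2)%:C.
Proof. by rewrite -dotE normE -rmorphXn. Qed.

Lemma rnorm_dot x y : rnorm (dot x y) <= rnorm x * rnorm y.
Proof.
rewrite -(@ler_pXn2r _ 2) ?nnegrE ?mulr_ge0 ?rnorm_ge0//.
rewrite -lecR rmorphXn /= -normE exprMn [leRHS]rmorphM /= -!dotxxE.
exact: (dot_cauchy_schwarz dot).
Qed.

Lemma rnorm_le_sqr x (k : R) : rnorm x ^+ 2 <= k * rnorm x -> 0 <= k ->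
  rnorm x <= k.
Proof.
have [->//|x0] := eqVneq (rnorm x) 0.
by rewrite expr2 ler_pM2r ?lt_neqAle ?rnorm_ge0 1?eq_sym ?x0.
Qed.

End Dot.

Section RealPart.
Variables (R : realType) (E : hilbertType R).
Implicit Types x y : E.

Lemma ReD (a b : R[i]) : Re (a + b) = Re a + Re b.
Proof. by case: a b => ? ? []. Qed.

Lemma ReN (a : R[i]) : Re (- a) = - Re a.
Proof. by case: a. Qed.

Lemma ReZ (t : R) (z : R[i]) : Re (t%:C * z) = t * Re z.
Proof. by case: z => a b /=; rewrite mul0r subr0. Qed.

Lemma conj_real (t : R) : ((t%:C : R[i])^*)%R = t%:C.
Proof. by apply/CrealP; rewrite complex_real. Qed.

Lemma Re_dotC x y : Re (dot x y) = Re (dot y x).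
Proof. by rewrite dotC; case: (dot y x). Qed.

Lemma rnormD_sqr x y :
  rnorm (x + y) ^+ 2 = rnorm x ^+ 2 + rnorm y ^+ 2 + 2 * Re (dot x y).
Proof.
by rewrite -!Re_dotxx !(dotDl, dotDr) !ReD (Re_dotC y x); ring.
Qed.

Lemma rnormZ_real (t : R) x : rnorm (t%:C *: x) = `|t| * rnorm x.
Proof. by rewrite rnormZ rnorm_real. Qed.

Lemma rnormB_sqr x y :
  rnorm (x - y) ^+ 2 = rnorm x ^+ 2 + rnorm y ^+ 2 - 2 * Re (dot x y).
Proof.
by rewrite rnormD_sqr rnormN -scaleN1r dotZr rmorphN1 mulN1r ReN mulrN.
Qed.

End RealPart.

(** * Limits with an explicit rate *)

Lemma rate_inv (R : realType) (n : nat) : 0 < (n.+1%:R : R)^-1.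
Proof. by rewrite invr_gt0 ltr0n. Qed.

Lemma archi_inv (R : realType) (k e : R) : 0 < e ->
  exists n : nat, k * n.+1%:R^-1 < e.
Proof.
move=> e0; have [k0|k0] := leP k 0.
  by exists 0; apply: le_lt_trans e0; rewrite mulr_le0_ge0// invr_ge0 ler0n.
exists (Num.truncn (k / e)).
rewrite ltr_pdivrMr ?ltr0n// mulrC -ltr_pdivrMr//.
by rewrite truncnS_gt// ltW// divr_gt0.
Qed.

Section Limits.
Variables (R : realType) (E : hilbertType R).

(** An explicit rate of convergence passes to the limit; all limits below are
    used only through such rates. *)
Lemma rate_cvg (u : nat -> E) (c : nat -> R) :
  (forall e, 0 < e -> exists n, c n < e) ->
  (forall n k, (n <= k)%N -> rnorm (u k - u n) <= c n) ->
  exists l, forall n, rnorm (l - u n) <= c n.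
Proof.
move=> c0 uc.
pose F : set_system E := (u @ \oo)%classic.
have Fc : cauchy F.
  apply/cauchy_ballP => e e0.
  have eE : e = (Re e)%:C.
    by case: e e0 => a b; rewrite ltcE /= => /andP[/eqP-> _].
  have e'0 : 0 < Re e by rewrite -ltcR -eE.
  have [n cn] := c0 (Re e / 2) (divr_gt0 e'0 (ltr0Sn _ 1)).
  rewrite near_map2; near=> i => /=.
  rewrite -ball_normE /= normE eE ltcR.
  apply: (le_lt_trans (rnorm_sub_trans (u n) _ _)).
  rewrite [rnorm (u n - _)]rnormC.
  have i1 : (n <= i.1)%N.
    near: i; exists ([set k | (n <= k)%N], setT)%classic; last by case=> ? ? [].
    by split; [exists n|exact: filterT].
  have i2 : (n <= i.2)%N.
    near: i; exists (setT, [set k | (n <= k)%N])%classic; last by case=> ? ? [].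
    by split; [exact: filterT|exists n].
  have := uc _ _ i1; have := uc _ _ i2; lra.
have Fl := cauchy_cvg F Fc.
exists (lim F) => n; apply/ler_addgt0Pr => e e0.
have e0' : 0 < e%:C by rewrite ltcR.
have /cvgrPdist_lt uF : (u x @[x --> \oo] --> lim F)%classic by exact: Fl.
have [k _ uk] := uF _ e0'.
have := uk (maxn n k) (leq_maxr _ _); rewrite /= normE ltcR => uk'.
apply: (le_trans (rnorm_sub_trans (u (maxn n k)) _ _)).
by have := uc _ _ (leq_maxl n k); lra.
Unshelve. all: by end_near. Qed.

End Limits.

(** First-order condition at a minimum, without derivatives: near t = 0 the
    sign of the form is that of the linear term. *)
Lemma linear_term_eq0 (R : realFieldType) (a b : R) : 0 <= a ->
  (forall t, 0 <= t ^+ 2 * a + 2 * t * b) -> b = 0.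
Proof.
(* Dividing by a + 1 rather than by a covers the case a = 0. *)
move=> a0 h; have := h (- b / (a + 1)).
have a1 : a + 1 != 0 by lra.
rewrite (_ : _ + _ = - (b ^+ 2 * (a + 2) / (a + 1) ^+ 2)); last by field.
rewrite oppr_ge0 pmulr_lle0 ?invr_gt0 ?exprn_gt0//; last lra.
rewrite pmulr_lle0; last lra.
by move=> b2; apply/eqP; rewrite -sqrf_eq0 eq_le b2 sqr_ge0.
Qed.

(** * Riesz representation and adjoints *)

Section Riesz.
Variables (R : realType) (H : hilbertType R) (f : H -> R[i]) (M : R).
Hypothesis fL : scalar f.
Hypothesis fM : forall x, rnorm (f x) <= M * rnorm x.

Let fD x y : f (x + y) = f x + f y.
Proof. by have := fL 1 x y; rewrite scale1r mul1r. Qed.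

Let fZ a x : f (a *: x) = a * f x.
Proof.
have f0 : f 0 = 0 by apply: (addrI (f 0)); rewrite -fD !addr0.
by have := fL a x 0; rewrite f0 !addr0.
Qed.

(* Up to a constant, J x is |x - l|^2 for the representing vector l, so l is
   found as the minimizer of J. *)
Let J x := rnorm x ^+ 2 - 2 * Re (f x).

Let J_ge x : - M ^+ 2 <= J x.
Proof.
have := le_trans (ler_norm _) (le_trans (Re_le_rnorm (f x)) (fM x)).
rewrite /J; have := sqr_ge0 (rnorm x - M); nra.
Qed.

Let J_mid x y :
  rnorm (x - y) ^+ 2 = 2 * J x + 2 * J y - 4 * J ((2^-1)%:C *: (x + y)).
Proof.
rewrite rnormB_sqr /J rnormZ_real exprMn rnormD_sqr fZ fD /= ReZ ReD.
by rewrite real_normK ?num_real//; field.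
Qed.

(** The parallelogram identity [J_mid] makes a minimizing sequence of J a
    Cauchy sequence.  The first-order condition at its limit l says that f and
    the inner product with l have the same real part, hence are equal by
    complex linearity. *)
Theorem riesz : exists l, forall x, f x = dot x l.
Proof.
pose A := [set J x | x in [set: H]]%classic.
have infA : has_inf A.
  by split; [exists (J 0), 0|exists (- M ^+ 2) => _ [x _ <-]].
have infP x : inf A <= J x by apply: ge_inf; [exact: infA.2|exists x].
have /choice[u uP] (n : nat) : exists x, J x < inf A + n.+1%:R^-1 ^+ 2.
  have e0 : 0 < n.+1%:R^-1 ^+ 2 :> R by rewrite exprn_gt0// rate_inv.
  by have [_ [x _ <-]] := inf_adherent e0 infA; exists x.
have [||l ul] := @rate_cvg _ _ u (fun n => 2 * n.+1%:R^-1).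
- by move=> e; exact: archi_inv.
- move=> n k nk; have k0 := rate_inv R k; have n0 := rate_inv R n.
  have kn : k.+1%:R^-1 <= n.+1%:R^-1 :> R.
    by rewrite lef_pV2 ?posrE ?ltr0n// ler_nat.
  rewrite -(@ler_pXn2r _ 2) ?nnegrE ?rnorm_ge0 ?mulr_ge0 ?(ltW n0)//.
  rewrite J_mid.
  have kn2 : k.+1%:R^-1 ^+ 2 <= n.+1%:R^-1 ^+ 2 :> R.
    by rewrite ler_pXn2r// nnegrE ltW.
  rewrite exprMn; move: kn2 (uP n) (uP k) (infP ((2^-1)%:C *: (u k + u n))).
  move: (J _) (J _) (J _) (_ ^-1 ^+ 2) (_ ^-1 ^+ 2) => *; lra.
have re h : Re (f h) = Re (dot h l).
  apply/eqP; rewrite eq_sym -subr_eq0; apply/eqP.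
  apply: (@linear_term_eq0 _ (rnorm h ^+ 2)) => [|t]; first exact: sqr_ge0.
  rewrite -oppr_le0; apply/ler_addgt0Pr => e e0; rewrite add0r.
  have [n ne] := archi_inv (1 + 4 * `|t| * rnorm h) e0.
  apply: ltW; apply: le_lt_trans ne.
  have n0 := rate_inv R n.
  have n1 : n.+1%:R^-1 <= 1 :> R by rewrite invf_le1 ?ltr0n// ler1n.
  have := infP (u n + t%:C *: h).
  rewrite /J rnormD_sqr rnormZ_real fD fZ /= ReD ReZ.
  rewrite exprMn real_normK ?num_real// dotZr conj_real ReZ => h1.
  (* The estimate is carried out at u n, where J is within (n+1)^-2 of its
     infimum, and transported to l. *)
  have h2 : Re (dot (u n) h) = Re (dot h l) - Re (dot (l - u n) h).
    by rewrite dotBl ReD ReN (Re_dotC l); ring.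
  have h3 : `|2 * t * Re (dot (l - u n) h)| <=
      2 * `|t| * (2 * n.+1%:R^-1 * rnorm h).
    rewrite normrM normrM (ger0_norm (_ : 0 <= 2))//.
    rewrite ler_wpM2l ?mulr_ge0//.
    apply: le_trans (Re_le_rnorm _) _; apply: le_trans (rnorm_dot _ _) _.
    by rewrite ler_wpM2r ?rnorm_ge0.
  have s2 : n.+1%:R^-1 ^+ 2 <= n.+1%:R^-1 :> R by rewrite expr2 ler_piMl// ltW.
  move: h1 (uP n) h3; rewrite h2 /J ler_norml.
  by move: s2; move: (_ ^-1) => ? ? ? ? /andP[? ?]; lra.
exists l => x; apply/eqP; rewrite eq_complex re eqxx /=.
have := re ('i *: x); rewrite fZ dotZl /=.
case: (f x) (dot x l) => a b [c d] /=.
by rewrite !(mul0r, mul1r, add0r, sub0r) => /oppr_inj ->.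
Qed.

End Riesz.

Section Operators.
Variable R : realType.
Implicit Types E F : hilbertType R.

Lemma BL_rnorm E F (T : BL E F) :
  exists2 M : R, 0 <= M & forall x, rnorm (T x) <= M * rnorm x.
Proof.
have [M M0 TM] := BL_bounded T; exists (rnorm M) => [|x].
  exact: rnorm_ge0.
by rewrite -lecR rmorphM /= -!normE (ger0_norm M0).
Qed.

Lemma bounded_linear_rnorm E F (f : E -> F) (M : R) :
  linear f -> 0 <= M -> (forall x, rnorm (f x) <= M * rnorm x) ->
  f \in @bounded_linear R E F.
Proof.
move=> fL M0 fM; apply/bounded_linearP; split=> //.
exists M%:C => [|x]; first by rewrite ler0c.
by rewrite !normE -rmorphM lecR.
Qed.

Lemma adjoint_exists E F (T : BL E F) :
  exists S : BL F E, forall x y, dot (T x) y = dot x (S y).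
Proof.
have [M M0 TM] := BL_rnorm T.
have /choice[S SP] (y : F) : exists l, forall x, dot (T x) y = dot x l.
  apply: (@riesz _ _ _ (M * rnorm y)) => [a u v|x].
  - by rewrite linearP dotDl dotZl.
  - by rewrite mulrAC (le_trans (rnorm_dot _ _))// ler_wpM2r ?rnorm_ge0.
have SL : linear S.
  by move=> a u v; apply: dot_inj => z; rewrite -SP !(dotDr, dotZr) -!SP.
have SM y : rnorm (S y) <= M * rnorm y.
  apply: rnorm_le_sqr; last by rewrite mulr_ge0 ?rnorm_ge0.
  rewrite -Re_dotxx -SP; apply: le_trans (ler_norm _) _.
  apply: le_trans (Re_le_rnorm _) _; apply: le_trans (rnorm_dot _ _) _.
  by rewrite mulrAC ler_wpM2r ?rnorm_ge0.
by exists (MkBL (bounded_linear_rnorm SL M0 SM)) => x y; exact: SP.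
Qed.

(** By [riesz], the set from which [adjoint] is chosen is not empty. *)
Lemma dot_adjoint E F (T : BL E F) x y : dot (T x) y = dot x (adjoint T y).
Proof.
rewrite /adjoint; case: xgetP => [S _ ->//|noS].
by have [S /noS] := adjoint_exists T.
Qed.

Lemma adjointE E F (T : BL E F) (S : F -> E) :
  (forall x y, dot (T x) y = dot x (S y)) -> adjoint T = S :> (F -> E).
Proof.
by move=> TS; apply/funext => y; apply: dot_inj => x; rewrite -dot_adjoint.
Qed.

(** Polarization: over the complex numbers, a quadratic form with real values,
    evaluated at x + y and x + iy, forces the operator to be self-adjoint. *)
Lemma psd_herm E (T : BL E E) : psd T -> forall x y, dot (T x) y = dot x (T y).
Proof.
move=> T0 x y; rewrite [RHS]dotC.
have im z : Im (dot (T z) z) = 0 by have := T0 z; rewrite lecE => /andP[/eqP->].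
have := im (x + y); rewrite [T _]linearD !(dotDl, dotDr).
have := im (x + 'i *: y); rewrite [T (_ + _)]linearD /= [T (_ *: _)]linearZ /=.
rewrite !(dotDl, dotDr, dotZl, dotZr).
have := im x; have := im y.
case: (dot (T x) x) (dot (T y) y) (dot (T x) y) (dot (T y) x).
move=> a b [a' b'] [c d] [c' d'] /= -> ->.
move=> h1 h2; apply/eqP; rewrite eq_complex /=.
apply/andP; split; apply/eqP; move: h1 h2.
all: rewrite ?(mul0r, mulr0, mul1r, mulr1, add0r, addr0, subr0, oppr0); lra.
Qed.

End Operators.

(** * Square roots of positive operators *)

Section SquareRoot.
Variable R : realType.

(** If y_0 = 0 and y_{n+1} = (1 + y_n^2) / 2, then gap n = 1 - y_n.  These y_n
    are the scalar majorants of the operator iteration below. *)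
Fixpoint gap (n : nat) : R :=
  if n is k.+1 then gap k - gap k ^+ 2 / 2 else 1.

Lemma gap_bounds n : 0 <= gap n <= 1.
Proof.
elim: n => [|n /andP[g0 g1]] /=; first by rewrite ler01 lexx.
by apply/andP; split; nra.
Qed.

Lemma gap_le n : gap n <= 2 * n.+1%:R^-1.
Proof.
elim: n => [|n IH]; first by rewrite invr1 mulr1 /=; lra.
have /andP[g0 g1] := gap_bounds n.
have : 0 < n.+1%:R^-1 :> R by exact: rate_inv.
have n2 : n.+2%:R^-1 = n.+1%:R^-1 / (1 + n.+1%:R^-1) :> R.
  have n0 := ler0n R n.
  by field; apply/andP; split; lra.
rewrite /= n2; move: IH; move: (gap n) g0 g1 (n.+1%:R^-1) => g g0 g1 s gs s0.
rewrite mulrA ler_pdivlMr; nra.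
Qed.

Variables (E : hilbertType R) (A : E -> E).
Hypotheses (AL : linear A) (Aherm : forall x y, dot (A x) y = dot x (A y)).
Hypothesis A1 : forall x, rnorm (A x) <= rnorm x.

(* Z solves 2 Z = A + Z^2 exactly when 1 - Z is a square root of 1 - A; it is
   the limit of Y_0 = 0, Y_{n+1} = (A + Y_n^2) / 2. *)
Let half : R[i] := (2^-1)%:C.

Let Y (n : nat) : E -> E :=
  iter n (fun (T : E -> E) x => half *: (A x + T (T x))) (fun=> 0).

Let YS n x : Y n.+1 x = half *: (A x + Y n (Y n x)).
Proof. by []. Qed.

Let Y_linear n : linear (Y n).
Proof.
elim: n => [|n IH] a x y; first by rewrite scaler0 addr0.
rewrite !YS AL !IH !scalerDr !scalerA [a * half]mulrC -!addrA.
by congr (_ + _); rewrite addrCA.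
Qed.

Let YB n x y : Y n (x - y) = Y n x - Y n y.
Proof. by rewrite -scaleN1r addrC Y_linear scaleN1r addrC. Qed.

Let Y_herm n x y : dot (Y n x) y = dot x (Y n y).
Proof.
elim: n x y => [|n IH] x y; first by rewrite dot0l dot0r.
by rewrite !YS dotZl dotZr conj_real dotDl dotDr Aherm !IH.
Qed.

Let Y_bound n x : rnorm (Y n x) <= (1 - gap n) * rnorm x.
Proof.
elim: n x => [|n IH] x; first by rewrite rnorm0 subrr mul0r.
rewrite YS rnormZ_real ger0_norm ?invr_ge0//=.
have h1 := le_trans (rnormD _ _) (lerD (A1 x) (IH (Y n x))).
have /andP[g0 g1] := gap_bounds n; have := IH x; have := rnorm_ge0 x.
nra.
Qed.

Let Y_le1 n x : rnorm (Y n x) <= rnorm x.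
Proof.
apply: le_trans (Y_bound n x) _; have /andP[g0 g1] := gap_bounds n.
by rewrite ler_piMl ?rnorm_ge0//; lra.
Qed.

(* Y' Y' - Y Y = Y' (Y' - Y) + (Y' - Y) Y, for Y = Y_n and Y' = Y_{n+1},
   reproduces the recursion of the scalar majorants. *)
Let Y_step n x : rnorm (Y n.+1 x - Y n x) <= (gap n - gap n.+1) * rnorm x.
Proof.
elim: n x => [|n IH] x.
  rewrite YS subr0 addr0 rnormZ_real ger0_norm ?invr_ge0//=.
  by have := A1 x; lra.
have -> : Y n.+2 x - Y n.+1 x = half *: (Y n.+1 (Y n.+1 x - Y n x) +
    (Y n.+1 (Y n x) - Y n (Y n x))).
  rewrite [Y n.+2 x]YS [in X in _ - X]YS YB subrKA -scalerBr.
  by rewrite opprD addrACA subrr add0r.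
rewrite rnormZ_real ger0_norm ?invr_ge0//.
have h1 := le_trans (rnormD _ _)
  (lerD (Y_bound n.+1 (Y n.+1 x - Y n x)) (IH (Y n x))).
have /andP[g0 g1] := gap_bounds n; have /andP[g0' g1'] := gap_bounds n.+1.
have := IH x; have := Y_bound n x; have := rnorm_ge0 x.
have e1 : gap n.+1 = gap n - gap n ^+ 2 / 2 by [].
have e2 : gap n.+2 = gap n.+1 - gap n.+1 ^+ 2 / 2 by [].
have d0 : 0 <= gap n - gap n.+1 by rewrite e1; nra.
rewrite e2; move: e1 {e2} h1 d0 g0 g1 g0' g1'.
move: (gap n.+1) (gap n) => g' g e1 h1 d0 g0 g1 g0' g1' x0 h2 h3.
have h4 : rnorm (Y n.+1 (Y n.+1 x - Y n x) + (Y n.+1 (Y n x) - Y n (Y n x))) <=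
    (1 - g') * ((g - g') * rnorm x) + (g - g') * ((1 - g) * rnorm x).
  apply: le_trans h1 _; apply: lerD; apply: ler_wpM2l => //; lra.
rewrite {h1 d0 g0' g1' h3}e1 in h4 *.
move: h4; move: (rnorm (_ + _)) (rnorm x) => u v; lra.
Qed.

Let Y_cauchy x n k : (n <= k)%N -> rnorm (Y k x - Y n x) <= gap n * rnorm x.
Proof.
move=> nk; suff : rnorm (Y k x - Y n x) <= (gap n - gap k) * rnorm x.
  have /andP[g0 g1] := gap_bounds k; have := rnorm_ge0 x; nra.
move: nk => /subnK <-; elim: (k - n)%N => [|i IH].
  by rewrite add0n !subrr rnorm0 mul0r.
apply: le_trans (rnorm_sub_trans (Y (i + n)%N x) _ _) _.
by rewrite addSn; have := Y_step (i + n) x; lra.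
Qed.

Let gap_archi (k e : R) : 0 < e -> exists n, gap n * k < e.
Proof.
move=> e0; have [n nk] := archi_inv (2 * `|k|) e0; exists n.
apply: le_lt_trans nk; have /andP[g0 _] := gap_bounds n.
apply: le_trans (ler_wpM2l g0 (ler_norm k)) _.
rewrite mulrAC ler_wpM2r ?normr_ge0 ?gap_le//.
Qed.

Let gap_eq0 (V : normedZmodType R[i]) (v : V) (k : R) :
  (forall n, rnorm v <= gap n * k) -> v = 0.
Proof.
move=> h; apply: rnorm0_eq0; apply/eqP; rewrite eq_le rnorm_ge0 andbT.
apply/ler_addgt0Pr => e e0; rewrite add0r.
by have [n ne] := gap_archi k e0; apply: ltW (le_lt_trans (h n) ne).
Qed.

(** Y_n is linear and self-adjoint, and 2 Y_{n+1} = A + Y_n^2.  Replacing Y_n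
    and Y_{n+1} by the limit Z costs errors that are multiples of gap n, which
    tends to 0. *)
Lemma quadratic_fixpoint : exists Z : E -> E,
  [/\ linear Z, forall x y, dot (Z x) y = dot x (Z y),
      forall x, rnorm (Z x) <= rnorm x &
      forall x, Z x + Z x = A x + Z (Z x)].
Proof.
have /choice[Z ZY] x : exists l, forall n, rnorm (l - Y n x) <= gap n * rnorm x.
  by apply: rate_cvg => [e|n k]; [exact: gap_archi|exact: Y_cauchy].
have Z1 x : rnorm (Z x) <= rnorm x.
  apply/ler_addgt0Pr => e e0; have [n ne] := gap_archi (rnorm x) e0.
  rewrite -[Z x](subrK (Y n x)); apply: le_trans (rnormD _ _) _.
  by have := ZY x n; have := Y_le1 n x; lra.
exists Z; split=> // [a x y|x y|x].
- apply/eqP; rewrite -subr_eq0; apply/eqP.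
  apply: (@gap_eq0 _ _ (rnorm (a *: x + y) + rnorm a * rnorm x + rnorm y)) => n.
  have -> : Z (a *: x + y) - (a *: Z x + Z y) =
      (Z (a *: x + y) - Y n (a *: x + y)) - (a *: (Z x - Y n x)) - (Z y - Y n y).
    by rewrite Y_linear; apply: dot_inj => z; rewrite !(dotBr, dotDr, dotZr); ring.
  apply: le_trans (rnormB _ _) _; rewrite mulrDr; apply: lerD (ZY _ _).
  apply: le_trans (rnormB _ _) _; rewrite mulrDr; apply: lerD (ZY _ _) _.
  by rewrite rnormZ mulrCA ler_wpM2l ?rnorm_ge0.
- apply/eqP; rewrite -subr_eq0; apply/eqP.
  apply: (@gap_eq0 _ _ (2 * (rnorm x * rnorm y))) => n.
  have -> : dot (Z x) y - dot x (Z y) = dot (Z x - Y n x) y - dot x (Z y - Y n y).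
    by rewrite dotBl dotBr Y_herm; ring.
  apply: le_trans (rnormB _ _) _.
  have h1 := le_trans (rnorm_dot _ _) (ler_wpM2r (rnorm_ge0 y) (ZY x n)).
  have h2 := le_trans (rnorm_dot _ _) (ler_wpM2l (rnorm_ge0 x) (ZY y n)).
  lra.
- apply/eqP; rewrite -subr_eq0; apply/eqP.
  apply: (@gap_eq0 _ _ (3 * rnorm x + rnorm (Z x))) => n.
  have -> : Z x + Z x - (A x + Z (Z x)) = (Z x - Y n.+1 x) + (Z x - Y n.+1 x)
     - (Y n (Z x - Y n x) + (Z (Z x) - Y n (Z x))).
    have -> : A x = Y n.+1 x + Y n.+1 x - Y n (Y n x).
      by rewrite YS -scalerDl -rmorphD /= -div1r -splitr scale1r addrK.
    by rewrite YB; apply: dot_inj => z; rewrite !(dotBr, dotDr); ring.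
  apply: le_trans (rnormB _ _) _.
  have h1 := rnormD (Z x - Y n.+1 x) (Z x - Y n.+1 x).
  have h2 := rnormD (Y n (Z x - Y n x)) (Z (Z x) - Y n (Z x)).
  have h3 := ZY x n.+1; have h4 := ZY x n; have h5 := ZY (Z x) n.
  have h6 := Y_le1 n (Z x - Y n x).
  have h7 : gap n.+1 * rnorm x <= gap n * rnorm x.
    by rewrite ler_wpM2r ?rnorm_ge0 //=; have := sqr_ge0 (gap n); lra.
  lra.
Qed.
End SquareRoot.

Section PsdSquareRoot.
Variables (R : realType) (E : hilbertType R) (T : BL E E).
Hypothesis T0 : psd T.

(** 0 <= T <= M gives |T x|^2 <= M <T x, x>: apply positivity of T to the
    vector x - T x / M.  Expanding the square of the norm below, this is what
    makes the cross term win. *)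
Lemma psd_contraction (M : R) : 0 < M ->
  (forall x, rnorm (T x) <= M * rnorm x) ->
  forall x, rnorm (x - (M^-1)%:C *: T x) <= rnorm x.
Proof.
move=> M0 TM x; rewrite -(@ler_pXn2r _ 2) ?nnegrE ?rnorm_ge0//.
have a0 : 0 < M^-1 by rewrite invr_gt0.
rewrite rnormB_sqr rnormZ_real exprMn real_normK ?num_real// dotZr conj_real ReZ.
rewrite -(psd_herm T0).
have : 0 <= Re (dot (T (x - (M^-1)%:C *: T x)) (x - (M^-1)%:C *: T x)).
  by have := T0 (x - (M^-1)%:C *: T x); rewrite lecE => /andP[].
rewrite [T (_ - _)]linearB /= [T (_ *: _)]linearZ /=.
rewrite !(dotBl, dotBr, dotZl, dotZr) conj_real.
rewrite (psd_herm T0 (T x) x) !(ReD, ReN, ReZ) Re_dotxx.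
have : Re (dot (T (T x)) (T x)) <= M * rnorm (T x) ^+ 2.
  apply: le_trans (ler_norm _) (le_trans (Re_le_rnorm _) _).
  by apply: le_trans (rnorm_dot _ _) _; rewrite expr2 mulrA ler_wpM2r ?rnorm_ge0.
have Ma : M * M^-1 = 1 by rewrite divff// gt_eqF.
move: (Re _) (Re _) (rnorm (T x)) (rnorm x) => v u w y uM h.
have h1 : M^-1 * (M^-1 * u) <= M^-1 * w ^+ 2.
  rewrite ler_pM2l//; have := ler_wpM2l (ltW a0) uM.
  by rewrite mulKf// gt_eqF.
have h2 : 0 <= v - M^-1 * w ^+ 2 by lra.
have := mulr_ge0 (ltW a0) h2; have := mulr_ge0 (ltW a0) (sqr_ge0 w); nra.
Qed.

(** S = sqrt M (1 - Z), where Z is the fixed point for A = 1 - T / M. *)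
Theorem psd_sqrt : exists S : BL E E,
  (forall x y, dot (S x) y = dot x (S y)) /\ forall x, S (S x) = T x.
Proof.
have [M' M'0 TM'] := BL_rnorm T; pose M := M' + 1.
have M0 : 0 < M by rewrite ltr_wpDl.
have TM x : rnorm (T x) <= M * rnorm x.
  by apply: le_trans (TM' x) _; rewrite ler_wpM2r ?rnorm_ge0// lerDl.
pose A x := x - (M^-1)%:C *: T x.
have AL : linear A.
  move=> a x y; apply: dot_inj => z.
  by rewrite /A linearP !(dotBr, dotDr, dotZr); ring.
have Aherm x y : dot (A x) y = dot x (A y).
  by rewrite /A dotBl dotBr dotZl dotZr conj_real (psd_herm T0).
have [Z [ZL Zherm Z1 ZA]] := quadratic_fixpoint AL Aherm (psd_contraction M0 TM).
pose s : R[i] := (Num.sqrt M)%:C.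
pose S x := s *: (x - Z x).
have SL : linear S.
  by move=> a x y; apply: dot_inj => z; rewrite /S ZL !(dotBr, dotDr, dotZr); ring.
have SM x : rnorm (S x) <= Num.sqrt M * 2 * rnorm x.
  rewrite rnormZ_real ger0_norm ?sqrtr_ge0// -mulrA ler_wpM2l ?sqrtr_ge0//.
  by apply: le_trans (rnormB _ _) _; have := Z1 x; lra.
have s0 : 0 <= Num.sqrt M * 2 by rewrite mulr_ge0 ?sqrtr_ge0.
exists (MkBL (bounded_linear_rnorm SL s0 SM)); split=> [x y|x] /=.
  by rewrite /S dotZl dotZr conj_real !(dotBl, dotBr) Zherm.
have Z0 : Z 0 = 0.
  by apply/rnorm0_eq0/eqP; rewrite eq_le rnorm_ge0 -[X in _ <= X](rnorm0 E) Z1.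
have ZZ a y : Z (a *: y) = a *: Z y by have := ZL a y 0; rewrite Z0 !addr0.
have ZB y y' : Z (y - y') = Z y - Z y'.
  by rewrite -scaleN1r addrC ZL scaleN1r addrC.
rewrite /S ZZ ZB.
rewrite -scalerBr scalerA opprB.
have -> : s * s = M%:C by rewrite -rmorphM /= -expr2 sqr_sqrtr// ltW.
have -> : x - Z x + (Z (Z x) - Z x) = (M^-1)%:C *: T x.
  have -> : Z (Z x) = Z x + Z x - A x by rewrite ZA [A x + _]addrC addrK.
  by apply: dot_inj => z; rewrite /A !(dotBr, dotDr); ring.
by rewrite scalerA -rmorphM /= divff ?gt_eqF// scale1r.
Qed.

End PsdSquareRoot.

(** * Orthonormal bases and coordinates of E^n *)

Section Bases.
Variable R : realType.
Implicit Type E : hilbertType R.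
Local Open Scope classical_set_scope.

Lemma hilbert_basis_exists E : exists B : set E, hilbert_basis B.
Proof.
have [F FP Ft|B [Bo Bm]] := @Zorn_bigcup E (@orthonormal_set R E).
  move=> x y [X FX Xx] [Y FY Yy].
  by have [XY|YX] := Ft _ _ FX FY; [apply: (FP Y)|apply: (FP X)] => //; auto.
exists B; split=> // B' B'o BB'; apply/seteqP; split=> //.
by apply: contrapT => B'B; apply: (Bm B') => //; split.
Qed.

(** Otherwise y, normalized, could be added to the maximal orthonormal set. *)
Lemma basis_orthogonal_eq0 E (B : set E) y : hilbert_basis B ->
  (forall b, B b -> dot y b = 0) -> y = 0.
Proof.
move=> [Bo Bm] yB; apply: contrapT => /eqP y0.
have r0 : rnorm y != 0 by apply: contraNneq y0 => /rnorm0_eq0 ->.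
pose e := ((rnorm y)^-1)%:C *: y.
have eB b : B b -> dot e b = 0 by move=> Bb; rewrite dotZl yB// mulr0.
have ee : dot e e = 1.
  rewrite dotZl dotZr conj_real dotxxE -!rmorphM /=.
  by rewrite [X in X%:C](_ : _ = 1) //; field.
have eNB : ~ B e by move=> /eB; rewrite ee => /eqP; rewrite oner_eq0.
apply: eNB; rewrite -(Bm (B `|` [set e])); [by right| |by left].
move=> u v [Bu|->] [Bv|->]; first exact: Bo.
- rewrite dotC eB// rmorph0; case: eqP => // ue; rewrite -ue in eB.
  by have := eB _ Bu; rewrite Bo// eqxx => /eqP; rewrite oner_eq0.
- rewrite eB//; case: eqP => // ev; rewrite -ev in Bv.
  by have := eB _ Bv; rewrite ee => /eqP; rewrite oner_eq0.
- by rewrite ee eqxx.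
Qed.

End Bases.

Lemma BL_sumE (R : realType) (H F : hilbertType R) (I : Type) (r : seq I)
    (T : I -> BL H F) (x : H) :
  (\sum_(i <- r) T i) x = \sum_(i <- r) T i x.
Proof. by elim/big_rec2: _ => // i u v _ <-. Qed.

Section Coordinates.
Variables (R : realType) (E : hilbertType R) (n : nat).
Implicit Types (x y : tensor E n) (e : E) (i : 'I_n).
Local Open Scope classical_set_scope.

Definition coord_in i e : tensor E n := [ffun j => if j == i then e else 0].

Lemma dot_tensor x y : dot x y = \sum_i dot (x i) (y i).
Proof. by []. Qed.

Lemma dot_coord_in x i e : dot x (coord_in i e) = dot (x i) e.
Proof.
rewrite dot_tensor (bigD1 i)//= ffunE eqxx big1 ?addr0// => j ji.
by rewrite ffunE (negPf ji) dot0r.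
Qed.

Lemma coord_bounded i :
  (fun x : tensor E n => x i) \in @bounded_linear R (tensor E n) E.
Proof.
apply: (@bounded_linear_rnorm _ _ _ _ 1) => // [a x y|x]; first by rewrite !ffunE.
by rewrite mul1r -lecR -!normE tensor_le_norm.
Qed.

Definition coord i : BL (tensor E n) E := MkBL (coord_bounded i).

(** The vectors coord_in i b, with b in a basis B of E, form a basis of E^n.
    It is presented as an image of the product of B and the first n integers
    in order that the bound on its cardinality be immediate. *)
Lemma hilbert_dim_tensor : hilbert_dim_le_mul (tensor E n) E n.
Proof.
have [B Bb] := hilbert_basis_exists E.
(* The default 0 is outside the range of interest, p.2 < n. *)
pose f (p : E * nat) : tensor E n :=
  oapp (fun i => coord_in i p.1) 0 (insub p.2).
have fE e i : f (e, val i) = coord_in i e by rewrite /f /= valK.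
exists (f @` (B `*` `I_n)), B; split=> //; last exact: card_image_le.
have mem x : (f @` (B `*` `I_n)) x -> exists i e, B e /\ x = coord_in i e.
  by move=> [[e k] [/= Be kn] <-]; exists (Ordinal kn), e; rewrite -fE.
have in_mem i e : B e -> (f @` (B `*` `I_n)) (coord_in i e).
  by move=> Be; exists (e, val i); rewrite ?fE//; split=> /=.
split=> [_ _ /mem[i [e [Be ->]]] /mem[i' [e' [Be' ->]]]|B' B'o BB'].
  rewrite dot_coord_in ffunE; have [<-|ii'] := eqVneq i' i.
    rewrite Bb.1//; congr (_%:R); congr nat_of_bool.
    apply/eqP/eqP => [->//|/ffunP/(_ i')]; by rewrite !ffunE eqxx.
  rewrite dot0l; case: eqP => // /ffunP/(_ i').
  rewrite !ffunE eqxx (negPf ii') => e'0.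
  by have := Bb.1 _ _ Be' Be'; rewrite -e'0 dot0l eqxx => /eqP; rewrite eq_sym oner_eq0.
apply/seteqP; split=> // x B'x; apply: contrapT => xB.
suff x0 : x = 0.
  by have := B'o _ _ B'x B'x; rewrite x0 dot0l eqxx => /eqP; rewrite eq_sym oner_eq0.
apply/ffunP => i; rewrite ffunE; apply: (basis_orthogonal_eq0 Bb) => e Be.
rewrite -dot_coord_in B'o//; last by apply/BB'/in_mem.
by case: eqP => // xe; case: xB; rewrite xe; exact: in_mem.
Qed.

Definition block_op (K : 'I_n -> 'I_n -> BL E E) :
  BL (tensor E n) (tensor E n) :=
  \sum_i \sum_j tensor_op (K i j) (delta_mx i j).

Lemma block_opE K x i : block_op K x i = \sum_j K i j (x j).
Proof.
rewrite /block_op BL_sumE sum_ffunE (bigD1 i)//= [X in _ + X]big1 => [|k ki].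
  rewrite addr0 BL_sumE sum_ffunE; apply: eq_bigr => j _.
  rewrite ffunE (bigD1 j)//= mxE !eqxx scale1r big1 ?addr0// => l lj.
  by rewrite mxE (negPf lj) andbF scale0r.
rewrite BL_sumE sum_ffunE big1// => j _; rewrite ffunE big1// => l _.
by rewrite mxE eq_sym (negPf ki) scale0r.
Qed.

(** P i is the row i of a self-adjoint square root S of the block operator.
    The adjoint of P j is then the column j of S, and the identity S S = T,
    read block by block, is the claim. *)
Theorem psd_block_factor (K : 'I_n -> 'I_n -> BL E E) : psd (block_op K) ->
  exists P : 'I_n -> BL (tensor E n) E,
    forall i j, K i j = BLcomp (P i) (adjoint (P j)).
Proof.
move=> /psd_sqrt[S [Sherm SS]]; exists (fun i => BLcomp (coord i) S) => i j.
have adjP : adjoint (BLcomp (coord j) S) = S \o coord_in j :> (E -> tensor E n).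
  by apply: adjointE => x e; rewrite /= -Sherm dot_coord_in.
apply/val_inj/funext => e.
change (K i j e = coord i (S (adjoint (BLcomp (coord j) S) e))).
rewrite adjP /= SS block_opE (bigD1 j)//= ffunE eqxx big1 ?addr0// => k kj.
by rewrite ffunE (negPf kj) linear0.
Qed.

End Coordinates.

(** * Evaluation of hereditary polynomials *)

Section Evaluation.
Variables (R : realType) (N m : nat) (E : hilbertType R).
Local Notation word := (m.-bseq 'I_N).
Implicit Type K : hereditary N m (BL E E).

Lemma word_pow_cons n (Z : 'I_N -> 'M[R[i]]_n) j w :
  word_pow Z (j :: w) = Z j *m word_pow Z w.
Proof. by rewrite /word_pow big_cons. Qed.

Lemma word_pow_adjoint n (Z : 'I_N -> 'M[R[i]]_n) (w : seq 'I_N) :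
  word_pow (fun j => (Z j)^t*)%sesqui (rev w) = ((word_pow Z w)^t*)%sesqui.
Proof.
elim: w => [|j w IH]; first by rewrite /word_pow !big_nil trmx1 map_mx1.
rewrite rev_cons word_pow_cons trmx_mul map_mxM -IH.
by rewrite /word_pow -cats1 big_cat big_cons big_nil /= mulr1.
Qed.

(** The summation index k is the inner index of the matrix product of Z^w and
    (Z^w')^*; for fixed k the summand is a Hermitian form in the columns k of
    these matrices. *)
Lemma dot_heval K n (Z : 'I_N -> 'M[R[i]]_n) (x y : tensor E n) :
  dot (heval K Z x) y = \sum_k \sum_(w : word) \sum_(w' : word) \sum_i \sum_j
    word_pow Z w i k * ((word_pow Z w' j k)^*)%R * dot (K w w' (x j)) (y i).
Proof.
rewrite /heval BL_sumE dot_suml [RHS]exchange_big; apply: eq_bigr => w _ /=.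
rewrite BL_sumE dot_suml [RHS]exchange_big; apply: eq_bigr => w' _ /=.
rewrite dot_tensor [RHS]exchange_big; apply: eq_bigr => i _ /=.
rewrite [RHS]exchange_big ffunE dot_suml; apply: eq_bigr => j _ /=.
rewrite dotZl word_pow_adjoint mxE mulr_suml; apply: eq_bigr => k _.
by rewrite !mxE.
Qed.

(** For fixed k the sum in [dot_heval] is the squared norm of the coordinate k
    of H(Z)^* x. *)
Lemma psd_herm_square (H : hilbertType R) (P : ncpoly N m (BL H E)) n
  (Z : 'I_N -> 'M[R[i]]_n) : psd (heval (herm_square P) Z).
Proof.
move=> x; rewrite dot_heval; apply: sumr_ge0 => k _.
pose v := \sum_(w : word) \sum_i ((word_pow Z w i k)^*)%R *: adjoint (P w) (x i).
suff -> : \sum_(w : word) \sum_(w' : word) \sum_i \sum_j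
    word_pow Z w i k * ((word_pow Z w' j k)^*)%R *
    dot (herm_square P w w' (x j)) (x i) = dot v v by exact: dot_ge0.
rewrite [RHS]dot_sumr; apply: eq_bigr => w _.
rewrite exchange_big dot_sumr; apply: eq_bigr => i _ /=.
rewrite dotZr conjCK dot_suml mulr_sumr; apply: eq_bigr => w' _.
rewrite dot_suml mulr_sumr; apply: eq_bigr => j _.
by rewrite dotZl mulrA /= dot_adjoint.
Qed.

End Evaluation.

(** * Weighted truncated shifts *)

(** The limit s -> 0, as an explicit choice of s: if Re a < 0 < Re b, then
    s = - Re a / (2 Re b - Re a) is at most 1 and already gives a negative
    real part. *)
Lemma perturb_ge0 (R : realType) (a b : R[i]) :
  (forall s : R, 0 < s -> 0 <= a + (s%:C) ^+ 2 * b) -> 0 <= a.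
Proof.
move=> h; have := h 1 ltr01; have := h 2 (ltr0Sn _ 1); rewrite !lecE /=.
case: a b h => a a' [b b'] h /= /andP[/eqP h1 _] /andP[/eqP h2 _].
apply/andP; split; first by apply/eqP; lra.
rewrite leNgt; apply/negP => a0.
have [b0|b0] := leP b 0; first by have := h 1 ltr01; rewrite lecE /= => /andP[_]; lra.
have s0 : 0 < - a / (2 * b - a) by rewrite divr_gt0//; lra.
have s1 : - a / (2 * b - a) <= 1 by rewrite ler_pdivrMr; lra.
have sb : (- a / (2 * b - a)) * (2 * b - a) = - a by rewrite divfK//; lra.
have := h _ s0; rewrite lecE /= => /andP[_]; move: s0 s1 sb.
move: (_ / _) => s; nra.
Qed.

Section WeightedShift.
Variables (R : realType) (N m : nat).
Local Notation word := (m.-bseq 'I_N).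
Local Notation n := #|{: word}|.
Implicit Types (i k : 'I_n) (w : seq 'I_N) (s : R).

Definition word_at (k : 'I_n) : word := enum_val k.

Lemma word_atK (w : word) : word_at (enum_rank w) = w.
Proof. exact: enum_rankK. Qed.

Lemma word_at_rank k : enum_rank (word_at k) = k.
Proof. exact: enum_valK. Qed.

Lemma word_at_inj : injective word_at.
Proof. exact: enum_val_inj. Qed.

Definition weight s i : R[i] := if word_at i == [::] :> seq _ then 1 else s%:C.

(** The truncated creation operator of the letter j, which prepends j to a
    word, conjugated by the diagonal matrix of weights. *)
Definition shift s (j : 'I_N) : 'M[R[i]]_n :=
  \matrix_(i, k) ((weight s i)^-1 *
    (word_at i == j :: word_at k :> seq _)%:R * weight s k).

Lemma weight_neq0 s i : 0 < s -> weight s i != 0.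
Proof.
by move=> s0; rewrite /weight; case: ifP; rewrite ?oner_eq0// fmorph_eq0 gt_eqF.
Qed.

(** Conjugation by the weights commutes with products, so Z^w is the conjugate
    of the operator that prepends w, and vanishes where wv is too long. *)
Lemma word_pow_shift s w i k : 0 < s ->
  word_pow (shift s) w i k = (weight s i)^-1 *
    (word_at i == w ++ word_at k :> seq _)%:R * weight s k.
Proof.
move=> s0; elim: w i => [|j w IH] i.
  rewrite /word_pow big_nil mxE /= (inj_eq val_inj) (inj_eq word_at_inj).
  by have [->|] := eqVneq i k; rewrite ?mulr0 ?mul0r// mulr1 mulVf ?weight_neq0.
rewrite word_pow_cons mxE /=.
have [iE|iN] := eqVneq (word_at i : seq _) (j :: w ++ word_at k); last first.
  rewrite mulr0 mul0r big1 // => l _; rewrite IH mxE.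
  have [lE|] := eqVneq (word_at l : seq _); last by rewrite !(mulr0, mul0r).
  by rewrite lE (negPf iN) !(mulr0, mul0r).
have szw : (size (w ++ word_at k) <= m)%N.
  by apply: ltnW; have := size_bseq (word_at i); rewrite iE.
pose l := enum_rank (Bseq szw : word).
have lE : word_at l = w ++ word_at k :> seq _ by rewrite word_atK.
rewrite (bigD1 l)//= big1 => [|l' l'l].
  by rewrite addr0 IH mxE lE iE !eqxx !mulr1 !mulrA mulfK ?weight_neq0.
rewrite IH; case: eqP => [l'E|]; last by rewrite !(mulr0, mul0r).
case/eqP: l'l; apply/word_at_inj/val_inj; rewrite /= l'E; exact/esym.
Qed.

Lemma shift_nilp s : 0 < s -> Nilp_rank m.+1 (shift s).
Proof.
move=> s0 w mw; apply/matrixP => i k; rewrite word_pow_shift// mxE.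
case: eqP => [iE|]; last by rewrite mulr0 mul0r.
have := size_bseq (word_at i); rewrite iE size_cat => /(leq_trans (leq_addr _ _)).
by rewrite leqNgt mw.
Qed.

Variables (E : hilbertType R) (K : hereditary N m (BL E E)).

(** Weighting the test vector cancels the outer factors of the conjugation and
    leaves the square of the weight at the inner index k. *)
Lemma dot_heval_shift s (y : tensor E n) : 0 < s ->
  let x : tensor E n := [ffun i => weight s i *: y i] in
  dot (heval K (shift s) x) x = \sum_k (weight s k) ^+ 2 *
    \sum_(w : word) \sum_(w' : word) \sum_i \sum_j
      (word_at i == w ++ word_at k :> seq _)%:R *
      (word_at j == w' ++ word_at k :> seq _)%:R * dot (K w w' (y j)) (y i).
Proof.
move=> s0 x; rewrite dot_heval; apply: eq_bigr => k _.
have wC i : ((weight s i)^*)%R = weight s i.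
  by rewrite /weight; case: ifP; rewrite ?rmorph1 ?conj_real.
do 2 (rewrite mulr_sumr; apply: eq_bigr => ? _).
do 2 (rewrite mulr_sumr; apply: eq_bigr => ? _).
rewrite !word_pow_shift// !ffunE [K _ _ _]linearZ /= dotZl dotZr !rmorphM /=
  fmorphV /= !wC rmorph_nat.
by field; rewrite !weight_neq0.
Qed.

(** In [dot_heval_shift] the term in which k is the empty word is the
    quadratic form of the block operator; every other term carries the factor s^2. *)
Theorem psd_shift_block :
  (forall s, 0 < s -> psd (heval K (shift s))) ->
  psd (block_op (fun i j => K (word_at i) (word_at j))).
Proof.
move=> Kpsd y.
pose G k := \sum_(w : word) \sum_(w' : word) \sum_i \sum_j
      (word_at i == w ++ word_at k :> seq _)%:R *
      (word_at j == w' ++ word_at k :> seq _)%:R * dot (K w w' (y j)) (y i).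
have [k0 k0E] : exists k0, word_at k0 = [::] :> seq _.
  by exists (enum_rank ([bseq] : word)); rewrite word_atK.
have -> : dot (block_op (fun i j => K (word_at i) (word_at j)) y) y = G k0.
  have sel (F : 'I_n -> R[i]) (w : word) :
    \sum_i (word_at i == w ++ word_at k0 :> seq _)%:R * F i = F (enum_rank w).
    rewrite (bigD1 (enum_rank w))//= k0E cats0 word_atK eqxx mul1r big1 ?addr0//.
    move=> i iw; rewrite (inj_eq val_inj); case: eqP => [wE|]; rewrite ?mul0r//.
    by case/eqP: iw; rewrite -wE word_at_rank.
  rewrite dot_tensor (reindex enum_rank); last first.
    by apply: onW_bij; exact: enum_rank_bij.
  apply: eq_bigr => w _; rewrite block_opE dot_suml (reindex enum_rank); last first.
    by apply: onW_bij; exact: enum_rank_bij.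
  apply: eq_bigr => w' _; rewrite !word_atK.
  rewrite -(sel (fun i => dot (K w w' (y (enum_rank w'))) (y i))).
  apply: eq_bigr => i _; rewrite -(sel (fun j => dot (K w w' (y j)) (y i))).
  by rewrite mulr_sumr; apply: eq_bigr => j _; rewrite mulrA.
apply: (@perturb_ge0 _ _ (\sum_(k | k != k0) G k)) => s s0.
have w0 : weight s k0 = 1 by rewrite /weight k0E.
have wk k : k != k0 -> weight s k = s%:C.
  move=> kk0; rewrite /weight ifN//; apply: contraNneq kk0 => kE.
  by apply/eqP/word_at_inj/val_inj; rewrite /= kE k0E.
suff <- : \sum_k weight s k ^+ 2 * G k =
    G k0 + s%:C ^+ 2 * \sum_(k | k != k0) G k.
  by rewrite -(dot_heval_shift _ s0); exact: Kpsd.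
rewrite (bigD1 k0)//= w0 expr1n mul1r mulr_sumr; congr (_ + _).
by apply: eq_bigr => k /wk ->.
Qed.

End WeightedShift.

(** * The factorization theorem *)

Lemma card_words N m : #|{: m.-bseq 'I_N}| = (\sum_(j < m.+1) N ^ j)%N.
Proof. by rewrite card_bseq card_ord. Qed.

Theorem theorem4 (R : realType) (N m : nat) (E : hilbertType R)
    (K : hereditary N m (BL E E)) :
  let d := (\sum_(j < m.+1) N ^ j)%N in
  let factorizes :=
    exists (H : hilbertType R) (P : ncpoly N m (BL H E)),
      hilbert_dim_le_mul H E d /\ K = herm_square P in
  ((forall n, (0 < n)%N ->
      forall Z : 'I_N -> 'M[R[i]]_n, Nilp Z -> psd (heval K Z))
    <-> factorizes)
  /\ ((forall Z : 'I_N -> 'M[R[i]]_d, Nilp_rank m.+1 Z -> psd (heval K Z))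
      -> factorizes).
Proof.
move=> d factorizes.
have suff_d : (forall Z : 'I_N -> 'M[R[i]]_d, Nilp_rank m.+1 Z -> psd (heval K Z))
    -> factorizes.
  rewrite /factorizes /d -card_words => Kpsd.
  have [P KP] := psd_block_factor (psd_shift_block
    (fun s s0 => Kpsd _ (shift_nilp s0))).
  exists (tensor E #|{: m.-bseq 'I_N}|), (P \o enum_rank).
  split; first exact: hilbert_dim_tensor.
  apply/funext => w; apply/funext => w'.
  by rewrite /herm_square /= -KP !word_atK.
split=> //; split=> [Kpsd|[H [P [_ ->]]] n _ Z _]; last exact: psd_herm_square.
apply: suff_d => Z ZN; apply: Kpsd; last by exists m.+1.
by rewrite /d big_ord_recl expn0.
Qed.
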